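(* Let $G$ be a graph with chromatic number $\chi(G)=k$. Fix a proper $k$-coloring of $G$ with color classes $V_1,\dots,V_k$. For each $i$, let $G_i$ be the graph with vertex set $V_i$ in which distinct $u,v\in V_i$ are adjacent if and only if $d_G(u,v)=2$. Then \[ \tau_2(G)\le k+\sum_{i=1}^k\left\lceil\sqrt{2\chi(G_i)}\right\rceil. \]
   Context: $d_G(u,v)$ denotes graph distance in $G$. A $2$-tone coloring of a graph $G$ assigns to each vertex $v$ a set $f(v)$ of exactly $2$ colors from a color set $C$ such that $|f(u)\cap f(v)|<d_G(u,v)$ for all distinct vertices $u,v$ (so adjacent vertices share no color and vertices at distance $2$ share at most one color). $\tau_2(G)$ is the minimum $|C|$ over all $2$-tone colorings of $G$. *)

(* Defs.v *)
From mathcomp Require Import all_boot.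

Set Implicit Arguments.
Unset Strict Implicit.
Unset Printing Implicit Defensive.

Record sgraph := SGraph {
  vertex :> finType;
  edge : rel vertex;
  edge_sym : symmetric edge;
  edge_irrefl : irreflexive edge
}.
Arguments edge {s}.

Section Distance.
Variable G : sgraph.
Implicit Types u v : G.

Definition walk (n : nat) u v : bool :=
  [exists p : n.-tuple G, path edge u p && (last u p == v)].

Lemma connect_walk u v : connect edge u v -> exists n, walk n u v.
Proof.
case/connectP => p pp ->; exists (size p).
by apply/existsP; exists (in_tuple p); rewrite pp eqxx.
Qed.

(* [None] is the infinite distance between distinct components. *)
Definition dist u v : option nat :=
  if decP (@idP (connect edge u v)) is left uv
  then Some (ex_minn (connect_walk uv)) else None.

Definition lt_dist (m : nat) u v : bool :=
  if dist u v is Some d then m < d else true.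

End Distance.

Section Coloring.
Variable G : sgraph.

Definition proper_coloring (C : finType) (c : G -> C) : bool :=
  [forall u, forall v, edge u v ==> (c u != c v)].

Definition colorable (n : nat) : bool :=
  [exists c : {ffun G -> 'I_n}, proper_coloring c].

Lemma colorable_exists : exists n, colorable n.
Proof.
exists #|G|; apply/existsP; exists [ffun v => enum_rank v].
apply/forallP => u; apply/forallP => v; apply/implyP => uv.
rewrite !ffunE (inj_eq enum_rank_inj).
by apply: contraTneq uv => ->; rewrite edge_irrefl.
Qed.

Definition chromatic_number : nat := ex_minn colorable_exists.

Definition two_tone_coloring (C : finType) (f : G -> {set C}) : bool :=
  [forall v, #|f v| == 2] &&
  [forall u, forall v, (u != v) ==> lt_dist #|f u :&: f v| u v].

Definition two_tone_colorable (n : nat) : bool :=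
  [exists f : {ffun G -> {set 'I_n}}, two_tone_coloring f].

Lemma two_tone_colorable_exists : exists n, two_tone_colorable n.
Proof.
pose T : finType := (G * bool)%type.
pose f (v : G) : {set 'I_#|T|} := [set enum_rank (v, b) | b : bool].
exists #|T|; apply/existsP; exists [ffun v => f v].
apply/andP; split.
  apply/forallP => v; rewrite ffunE card_imset ?card_bool //.
  by move=> b b' /enum_rank_inj [].
apply/forallP => u; apply/forallP => v; apply/implyP => uv; rewrite !ffunE.
have -> : f u :&: f v = set0.
  apply/setP => x; rewrite !inE; apply/negP => /andP[/imsetP[b _ ->]].
  by case/imsetP => b' _ /enum_rank_inj [/eqP]; rewrite (negbTE uv).
rewrite cards0 /lt_dist /dist; case: decP => // h.
case: ex_minnP => -[|//] /existsP[p]; rewrite (tuple0 p) /= => /eqP uv'.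
by rewrite uv' eqxx in uv.
Qed.

Definition tau2 : nat := ex_minn two_tone_colorable_exists.

End Coloring.

Section DistanceTwoGraph.
Variables (G : sgraph) (A : {set G}).

Definition dist2_rel : rel {v : G | v \in A} :=
  fun u v => (u != v) && (dist (val u) (val v) == Some 2).

Lemma walk_sym n (u v : G) : walk n u v -> walk n v u.
Proof.
case/existsP => p /andP[pp /eqP lp]; apply/existsP.
have sz : size (rev (belast u p)) == n by rewrite size_rev size_belast size_tuple.
exists (Tuple sz) => /=; apply/andP; split.
  by rewrite -lp rev_path (eq_path (e' := edge)) // => x y; rewrite edge_sym.
by rewrite -lp; case: (tval p) => //= x s; rewrite rev_cons last_rcons.
Qed.

Lemma dist_sym (u v : G) : dist u v = dist v u.
Proof.
have cs := sym_connect_sym (@edge_sym G).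
rewrite /dist; case: decP => uv; case: decP => vu //; last 2 first.
- by case: vu; rewrite cs.
- by case: uv; rewrite cs.
congr Some; case: ex_minnP => m wm mm; case: ex_minnP => n wn mn.
by apply/eqP; rewrite eqn_leq mm ?mn // walk_sym.
Qed.

Lemma dist2_sym : symmetric dist2_rel.
Proof. by move=> u v; rewrite /dist2_rel eq_sym dist_sym. Qed.

Lemma dist2_irrefl : irreflexive dist2_rel.
Proof. by move=> u; rewrite /dist2_rel eqxx. Qed.

Definition dist2_graph : sgraph := SGraph dist2_sym dist2_irrefl.

End DistanceTwoGraph.

Definition color_class (G : sgraph) (C : finType) (c : G -> C) (i : C) : {set G} :=
  [set v | c v == i].

(* Main.v *)
Require Import Defs.
From mathcomp Require Import all_boot all_order all_algebra.
From mathcomp Require Import reals.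

(** Give each class [V_i] its own palette of [m_i + 1] colors, where
    [m_i] is the ceiling of [sqrt (2 chi(G_i))].  Such a palette contains
    [m_i (m_i + 1) / 2 >= chi(G_i)] pairs, so the colors of an optimal coloring
    of [G_i] can be replaced by distinct pairs.  Vertices in different classes
    then share no color, and vertices of one class at distance 2 receive
    distinct pairs, hence share at most one color. *)

Lemma chromatic_number_coloring (G : sgraph) :
  exists c : G -> 'I_(chromatic_number G), proper_coloring c.
Proof.
rewrite /chromatic_number; case: ex_minnP => n /existsP[c cP] _.
by exists c.
Qed.

(** The definition of [tau2] only admits palettes ['I_n]. Renaming colors along the injection
    [enum_rank] preserves the sizes of color sets and of their intersections, so any finite type can
    serve as palette. *)
Lemma tau2_le_card (G : sgraph) (C : finType) (f : G -> {set C}) :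
  two_tone_coloring f -> tau2 G <= #|C|.
Proof.
case/andP=> /forallP f2 /forallP fD; rewrite /tau2.
case: ex_minnP => n _; apply; apply/existsP.
exists [ffun v => enum_rank @: f v]; apply/andP; split.
  by apply/forallP => v; rewrite ffunE (card_imset _ enum_rank_inj).
apply/forallP => u; apply/forallP => v; rewrite !ffunE.
rewrite -imsetI ?(card_imset _ enum_rank_inj); first exact: (forallP (fD u)).
by move=> x y _ _; apply: enum_rank_inj.
Qed.

Lemma distxx (G : sgraph) (u : G) : dist u u = Some 0.
Proof.
rewrite /dist; case: decP => [uu|]; last by rewrite connect0.
case: ex_minnP => n _ min_n; congr Some; apply/eqP; rewrite -leqn0 min_n //.
by apply/existsP; exists [tuple]; rewrite /= eqxx.
Qed.

Lemma dist0_eq (G : sgraph) (u v : G) : dist u v = Some 0 -> u = v.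
Proof.
rewrite /dist; case: decP => // uv [].
case: ex_minnP => n + _ n0; rewrite {}n0.
by case/existsP => p; rewrite (tuple0 p) /= => /eqP.
Qed.

Lemma dist1_edge (G : sgraph) (u v : G) : dist u v = Some 1 -> edge u v.
Proof.
rewrite /dist; case: decP => // uv [].
case: ex_minnP => n + _ n1; rewrite {}n1.
case/existsP => p; case/tupleP: p => x p; rewrite (tuple0 p) /= andbT.
by case/andP=> + /eqP <-.
Qed.

(** Two pairs share at most two colors, so only distances 1 and 2 impose a constraint. *)
Lemma two_tone_coloringP (G : sgraph) (C : finType) (f : G -> {set C}) :
    (forall v, #|f v| = 2) ->
    (forall u v, edge u v -> [disjoint f u & f v]) ->
    (forall u v, dist u v = Some 2 -> f u != f v) ->
  two_tone_coloring f.
Proof.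
move=> f2 fE fD; apply/andP; split; first by apply/forallP => v; rewrite f2.
apply/forallP => u; apply/forallP => v; apply/implyP => uv.
have le2 : #|f u :&: f v| <= 2 by rewrite -(f2 u) subset_leq_card ?subsetIl.
rewrite /lt_dist; case E: (dist u v) => [[|[|[|n]]]|] //.
- by rewrite (dist0_eq _ _ _ E) eqxx in uv.
- by have := fE _ _ (dist1_edge _ _ _ E); rewrite -setI_eq0 => /eqP ->; rewrite cards0.
- rewrite ltn_neqAle le2 andbT; apply: contra (fD _ _ E) => /eqP I2.
  (* If the intersection has two elements, it fills both pairs, which forces [f u = f v]. *)
  have eqI (w : G) : f u :&: f v \subset f w -> f u :&: f v = f w.
    by move=> sI; apply/eqP; rewrite eqEcard sI I2 f2.
  by rewrite -(eqI u (subsetIl _ _)) {1}(eqI v (subsetIr _ _)).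
- exact: leq_ltn_trans le2 _.
Qed.

Lemma pair_injection (C : finType) (n : nat) : n <= 'C(#|C|, 2) ->
  exists2 P : 'I_n -> {set C}, injective P & forall x, #|P x| = 2.
Proof.
rewrite -card_draws => le_n.
exists (fun x => enum_val (widen_ord le_n x)).
  by move=> x y /enum_val_inj/(congr1 val) exy; apply: val_inj.
by move=> x; have := enum_valP (widen_ord le_n x); rewrite inE => /eqP.
Qed.

Lemma dist2_pair_coloring (G : sgraph) (A : {set G}) (C : finType) :
    chromatic_number (dist2_graph A) <= 'C(#|C|, 2) ->
  exists h : G -> {set C}, {in A, forall v, #|h v| = 2} /\
    {in A &, forall u v, dist u v = Some 2 -> h u != h v}.
Proof.
case/pair_injection=> P injP P2.
have [g /forallP gP] := chromatic_number_coloring (dist2_graph A).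
(* The value [set0] outside [A] is a mere default: both requirements concern [A] only. *)
exists (fun v => if insub v is Some w then P (g w) else set0); split=> [v vA|].
  by rewrite insubT P2.
move=> u v uA vA uv; rewrite !insubT (inj_eq injP).
have /implyP := forallP (gP (Sub u uA)) (Sub v vA); apply.
rewrite /edge /= /dist2_rel /= uv eqxx andbT.
apply/negP => /eqP/(congr1 val) /= euv.
by move: uv; rewrite -euv distxx.
Qed.

Lemma tau2_le_sum_palettes (G : sgraph) (k : nat) (c : G -> 'I_k)
    (m : 'I_k -> nat) : proper_coloring c ->
    (forall i, chromatic_number (dist2_graph (color_class c i)) <= 'C(m i, 2)) ->
  tau2 G <= \sum_i m i.
Proof.
move=> /forallP cP chi_le.
have {chi_le} chi_le i :
    chromatic_number (dist2_graph (color_class c i)) <= 'C(#|'I_(m i)|, 2).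
  by rewrite card_ord.
have [h hP] := fin_all_exists (fun i => dist2_pair_coloring _ _ _ (chi_le i)).
have h2 v : #|h (c v) v| = 2 by apply: (hP _).1; rewrite inE.
have hD u v : c u = c v -> dist u v = Some 2 -> h (c v) u != h (c v) v.
  by move=> cuv; apply: (hP _).2; rewrite inE ?cuv.
(* The dependent sum makes the palettes disjoint: the tag of a color is the class of every vertex
   that uses it. *)
pose T := {i : 'I_k & 'I_(m i)}.
have injT i : injective (fun x : 'I_(m i) => Tagged (fun i => 'I_(m i)) x : T).
  by move=> x y /eqP; rewrite eq_Tagged => /eqP.
pose f v : {set T} := [set (Tagged (fun i => 'I_(m i)) x : T) | x in h (c v) v].
have tag_f v x : x \in f v -> tag x = c v by case/imsetP=> y _ ->.
have cardT : #|{: T}| = \sum_i m i.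
  rewrite card_tagged sumnE big_map big_enum /=.
  by apply: eq_bigr => i _; rewrite card_ord.
rewrite -cardT; apply: (tau2_le_card _ _ f); apply: two_tone_coloringP.
- by move=> v; rewrite (card_imset _ (injT _)) h2.
- move=> u v uv; rewrite disjoint_subset; apply/subsetP => x /tag_f xu.
  rewrite inE; apply/negP => /tag_f; rewrite xu => cuv.
  by have := forallP (cP u) v; rewrite uv cuv eqxx.
- move=> u v uv; apply/negP => /eqP fuv.
  (* Equal pairs are nonempty, so the tag of a shared color puts both vertices in one class, where
     [hD] applies. *)
  have cuv : c u = c v.
    have /card_gt0P[x xu] : 0 < #|f u| by rewrite (card_imset _ (injT _)) h2.
    by rewrite -(tag_f u x xu) (tag_f v x) // -fuv.
  have /negP := hD u v cuv uv; apply; apply/eqP.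
  by move: fuv; rewrite /f cuv => /imset_inj; apply; apply: injT.
Qed.

Import Order.TTheory GRing.Theory Num.Theory.
Local Open Scope ring_scope.

(** With [m] the ceiling, [m ^ 2 >= 2 * n], hence [m * (m + 1) / 2 >= n]. *)
Lemma leq_bin2_ceil_sqrt (R : realType) (n : nat) :
  (n <= 'C(`|Num.ceil (Num.sqrt (2 * n%:R : R))|.+1, 2))%N.
Proof.
set s := Num.sqrt _; set m := `|_|%N.
have s0 : 0 <= s by apply: sqrtr_ge0.
have sm : s <= m%:R.
  (* The ceiling is nonnegative because its argument exceeds -1, so the absolute value changes
     nothing. *)
  by rewrite natr_absz ger0_norm ?ceil_ge // ceil_ge0 (lt_le_trans _ s0) ?ltrN10.
have : (2 * n <= m ^ 2)%N.
  rewrite -(ler_nat R) natrM natrX.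
  by rewrite -[leLHS]sqr_sqrtr ?mulr_ge0 ?ler0n // lerXn2r ?nnegrE.
rewrite bin2 /= mul2n => nm.
rewrite -[n in (n <= _)%N]doubleK half_leq // (leq_trans nm) //.
by rewrite mulSn expnS expn1 leq_addl.
Qed.

Theorem theorem1p12 (R : realType) (G : sgraph) (k : nat)
    (chiG : chromatic_number G = k)
    (c : G -> 'I_k) (c_proper : proper_coloring c) :
  (tau2 G)%:Z <=
    k%:Z + \sum_(i < k)
      Num.ceil (Num.sqrt (2 * (chromatic_number
                                 (dist2_graph (color_class c i)))%:R : R)).
Proof.
have := tau2_le_sum_palettes G k c _ c_proper
  (fun i => leq_bin2_ceil_sqrt R (chromatic_number (dist2_graph (color_class c i)))).
rewrite -lez_nat => /le_trans; apply.
(* The one extra color in each of the [k] palettes accounts for the summand [k]. *)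
under eq_bigr do rewrite -add1n.
rewrite big_split /= sum1_card card_ord PoszD lerD2l.
rewrite (big_morph Posz PoszD (erefl _)) ler_sum // => i _.
by rewrite gez0_abs // ceil_ge0 (lt_le_trans _ (sqrtr_ge0 _)) ?ltrN10.
Qed.
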